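(* Let $H$ and $K$ be finite Abelian groups, let $\psi: K \to \operatorname{Aut}(H)$ be a group homomorphism, and let $H \rtimes_{\psi} K$ be the corresponding semidirect product. Then there exists a supercharacter theory $A$ of the direct product $H \times K$ which is isomorphic, as a supercharacter theory, to the minimal supercharacter theory of $H \rtimes_{\psi} K$.
   Context: For a finite group $G$ with identity $e$, let $*$ denote the usual product on the group algebra $\mathbb{C}G$, and let $\circ$ denote the Hadamard product, $\left(\sum_{g\in G} a_g g\right)\circ\left(\sum_{g\in G} b_g g\right)=\sum_{g\in G}(a_g b_g) g$. A supercharacter theory for $G$ is a pair $(\mathcal{X},\mathcal{K})$, where $\mathcal{X}$ is a partition of the set $\operatorname{Irr}(G)$ of irreducible complex characters and $\mathcal{K}$ is a partition of the set of conjugacy classes of $G$ (each part being identified with the union of its classes, a subset of $G$), such that $\{e\}\in\mathcal{K}$, the singleton of the trivial character is in $\mathcal{X}$, $|\mathcal{X}|=|\mathcal{K}|$, and for each $X\in\mathcal{X}$ the function $\sigma_X=\sum_{\chi\in X}\chi(e)\chi$ is constant on each member of $\mathcal{K}$. Supercharacter theories of $G$ are in bijective correspondence with (and are identified with) the $\mathbb{C}$-linear subspaces $A$ of the center $Z(\mathbb{C}G)$ that contain $e$ and $\sum_{g\in G} g$ and are closed under both $*$ and $\circ$; the subspace corresponding to $(\mathcal{X},\mathcal{K})$ has basis $\{\widehat{L}: L\in\mathcal{K}\}$, where $\widehat{L}=\sum_{g\in L} g$. The minimal supercharacter theory of $G$ is the one in which each conjugacy class is a part of $\mathcal{K}$ and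 $\mathcal{X}$ consists of singletons; the corresponding algebra is $Z(\mathbb{C}G)$. A homomorphism of supercharacter theories $\phi:A\to B$ (with $A$ a supercharacter theory for a finite group $G_1$ and $B$ one for a finite group $G_2$, both viewed as algebras) is a $\mathbb{C}$-linear map with $\phi(x*y)=\phi(x)*\phi(y)$ and $\phi(x\circ y)=\phi(x)\circ\phi(y)$ for all $x,y\in A$; an isomorphism is a bijective homomorphism. The semidirect product $H\rtimes_\psi K$ has underlying set $H\times K$ and multiplication $(h_1,k_1)(h_2,k_2)=(h_1\psi(k_1)(h_2),k_1k_2)$. *)

(* Defs.v *)
From HB Require Import structures.
From mathcomp Require Import all_boot all_order all_algebra.
From mathcomp Require Import all_fingroup all_solvable all_field all_character.
From mathcomp Require Import reals complex.

Set Implicit Arguments.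
Unset Strict Implicit.
Unset Printing Implicit Defensive.

Import GRing.Theory.
Local Open Scope group_scope.

(** ** Semidirect products *)

(* The product of [{perm hT}] is composition in diagrammatic order,
   [(s * t) x = t (s x)], so [aut_homM], and not [{morph psi : k1 k2 / k1 * k2}],
   says that psi is a homomorphism for the usual composition in Aut(H). *)
Record aut_hom (kT hT : finGroupType) := AutHom {
  aut_hom_val :> kT -> {perm hT};
  aut_hom_Aut : forall k, aut_hom_val k \in Aut [set: hT];
  aut_homM : forall k1 k2 h,
    aut_hom_val (k1 * k2) h = aut_hom_val k1 (aut_hom_val k2 h)
}.

Section SemidirectProduct.

Variables hT kT : finGroupType.

(* A wrapper of H x K, so as not to clash with the direct product structure
   already present on the product type; the parameter [psi] only serves to
   select the group law. *)
Record semidirect (psi : aut_hom kT hT) : predArgType :=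
  SemiPair { sd_val : hT * kT }.

Coercion sd_val : semidirect >-> prod.

Variable psi : aut_hom kT hT.

Local Notation sdT := (semidirect psi).
Local Notation Sd := (@SemiPair psi).

HB.instance Definition _ := [isNew for @sd_val psi].
#[hnf] HB.instance Definition _ := [Finite of sdT by <:].

Definition sd_mul (x y : sdT) := Sd (x.1 * psi x.2 y.1, x.2 * y.2).
Definition sd_one := Sd (1, 1).
Definition sd_inv (x : sdT) := Sd (psi x.2^-1 x.1^-1, x.2^-1).

Lemma psi_morph k : {morph psi k : h1 h2 / h1 * h2}.
Proof.
by move=> h1 h2; apply: (morphicP (Aut_morphic (aut_hom_Aut psi k)));
   rewrite inE.
Qed.

Lemma psi_id h : psi 1 h = h.
Proof. by apply: (@perm_inj _ (psi 1)); rewrite -aut_homM mulg1. Qed.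

Lemma sd_mulA : associative sd_mul.
Proof.
move=> [[h1 k1]] [[h2 k2]] [[h3 k3]]; rewrite /sd_mul /=.
by rewrite psi_morph aut_homM !mulgA.
Qed.

Lemma sd_mul1 : left_id sd_one sd_mul.
Proof. by move=> [[h k]]; rewrite /sd_mul /= psi_id !mul1g. Qed.

Lemma sd_mulV : left_inverse sd_one sd_inv sd_mul.
Proof.
move=> [[h k]]; rewrite /sd_mul /sd_inv /= -psi_morph !mulVg.
by congr (Sd (_, _)); apply: (mulgI (psi k^-1 1)); rewrite -psi_morph !mulg1.
Qed.

HB.instance Definition _ :=
  Finite_isGroup.Build sdT sd_mulA sd_mul1 sd_mulV.

End SemidirectProduct.

(** ** Supercharacter theories *)

Section Supercharacters.

Variable gT : finGroupType.
Local Notation G := [set: gT].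

Definition sigma (X : {set Iirr G}) : 'CF(G) :=
  (\sum_(i in X) 'chi_i 1%g *: 'chi_i)%R.

(* [Iirr G] indexes the irreducible characters, ['chi_0] being the trivial one.
   Superclasses are kept as sets of conjugacy classes; the subset of G
   identified with the part L is [cover L]. Complex irreducible characters have
   algebraic values, so the theory is stated with the algC-valued ['chi_i],
   whatever the coefficient field of the group algebra below. *)
Record scTheory := ScTheory {
  sc_chars : {set {set Iirr G}};
  sc_classes : {set {set {set gT}}};
  sc_chars_partition : partition sc_chars [set: Iirr G];
  sc_classes_partition : partition sc_classes (classes G);
  sc_class1 : [set [set 1]] \in sc_classes;
  sc_char1 : [set 0%R] \in sc_chars;
  sc_card : #|sc_chars| = #|sc_classes|;
  sc_constant : forall X L, X \in sc_chars -> L \in sc_classes ->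
    {in cover L &, forall g1 g2, sigma X g1 = sigma X g2}
}.

Definition min_chars : {set {set Iirr G}} := [set [set i] | i in [set: Iirr G]].
Definition min_classes : {set {set {set gT}}} := [set [set c] | c in classes G].

Lemma partition_singletons (T : finType) (A : {set T}) :
  partition [set [set x] | x in A] A.
Proof.
apply/and3P; split.
- rewrite /cover; apply/eqP/setP=> x; apply/bigcupP/idP.
    by case=> _ /imsetP[y Ay ->] /set1P->.
  by move=> Ax; exists [set x]; rewrite ?set11 ?imset_f.
- apply/trivIsetP=> _ _ /imsetP[x _ ->] /imsetP[y _ ->] neq_xy.
  by rewrite disjoints1 inE; apply: contra neq_xy => /eqP->.
- by apply/imsetP=> -[x _ /setP/(_ x)]; rewrite !inE eqxx.
Qed.

Lemma min_class1 : [set [set 1]] \in min_classes.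
Proof. by rewrite imset_f //; apply/imsetP; exists 1; rewrite ?class1G. Qed.

Lemma min_char1 : [set 0%R] \in min_chars.
Proof. by rewrite imset_f ?inE. Qed.

Lemma min_card : #|min_chars| = #|min_classes|.
Proof. by rewrite !(card_imset _ set1_inj) cardsT card_ord NirrE. Qed.

Lemma min_constant X L : X \in min_chars -> L \in min_classes ->
  {in cover L &, forall g1 g2, sigma X g1 = sigma X g2}.
Proof.
move=> _ /imsetP[_ /imsetP[g _ ->] ->] g1 g2; rewrite /cover big_set1.
by move=> /imsetP[x Gx ->] /imsetP[y Gy ->]; rewrite !cfunJ.
Qed.

Definition minimal_theory : scTheory :=
  ScTheory (partition_singletons _) (partition_singletons _)
    min_class1 min_char1 min_card min_constant.

End Supercharacters.

(** ** Group algebras and the algebra of a supercharacter theory *)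

(* Elements of CG are coefficient functions; [C^o] makes C a vector space over
   itself. *)
Notation galg C gT := {ffun gT -> C^o}.

Section GroupAlgebra.

Variables (C : fieldType) (gT : finGroupType).
Implicit Types a b : galg C gT.

Definition gconv a b : galg C gT :=
  [ffun g => (\sum_(h : gT) a h * b (h^-1 * g)%g)%R].

Definition ghadamard a b : galg C gT := [ffun g => (a g * b g)%R].

Definition class_sum (L : {set {set gT}}) : galg C gT :=
  [ffun g => ((g \in cover L)%:R)%R].

Definition sc_algebra (A : scTheory gT) : {vspace galg C gT} :=
  (<<[seq class_sum L | L in sc_classes A]>>)%VS.

End GroupAlgebra.

(** ** Homomorphisms *)

Section Homomorphisms.

Variables (C : fieldType) (gT1 gT2 : finGroupType).
Variables (A : scTheory gT1) (B : scTheory gT2).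

Local Notation algA := (sc_algebra C A).
Local Notation algB := (sc_algebra C B).

(* A map from the algebra of A to that of B is encoded by a function on the
   ambient group algebras; its values outside the algebra of A are irrelevant. *)
Record sc_hom (phi : galg C gT1 -> galg C gT2) : Prop := ScHom {
  sc_hom_sub : forall x, x \in algA -> phi x \in algB;
  sc_hom_linear : forall (c : C) x y, x \in algA -> y \in algA ->
    phi (c *: x + y)%R = (c *: phi x + phi y)%R;
  sc_hom_conv : forall x y, x \in algA -> y \in algA ->
    phi (gconv x y) = gconv (phi x) (phi y);
  sc_hom_hadamard : forall x y, x \in algA -> y \in algA ->
    phi (ghadamard x y) = ghadamard (phi x) (phi y)
}.

Definition sc_iso (phi : galg C gT1 -> galg C gT2) : Prop :=
  [/\ sc_hom phi,
      {in algA &, injective phi}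
    & forall y, y \in algB -> exists2 x, x \in algA & phi x = y].

Definition sc_isomorphic : Prop := exists phi, sc_iso phi.

End Homomorphisms.

(* Main.v *)
Require Import Defs.
From mathcomp Require Import all_boot all_order all_algebra.
From mathcomp Require Import all_fingroup all_solvable all_field all_character.
From mathcomp Require Import reals complex ring.

(** The isomorphism is nothing but the identification of H x K with the
    semidirect product G as sets: it carries the centre of CG onto an algebra
    of functions on H x K, and the point is that convolution does not notice
    the twist.  Indeed, if u and w are pairs, the quotient u^-1 w formed in
    H x K is conjugate in G to the quotient u^-1 w formed in G, because K is
    abelian (semidirect_ldiv_class).  Hence, for any p and any class function
    q, the sums of p(u) q(u^-1 w) over u are the same for the two group laws
    (transport_conv).

    The rest works for any bijection from a group G to an abelian group A
    having this conjugacy property, and consists in finding the partition of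
    Irr(A) that goes with the superclasses, namely with the images of the
    conjugacy classes of G.  For each irreducible character chi of G, the
    function chi(1) chi is |G| times a central idempotent of CG, and these
    idempotents are orthogonal with sum 1 (scaled_irr_conv, scaled_irr_sum).
    Since the convolution is the same in A, their Fourier transforms on A are pairwise
    orthogonal functions on Irr(A) with values 0 and 1 and sum 1, that is, the
    indicator functions of a partition of Irr(A), whose parts X correspond
    bijectively to the irreducible characters of G.  Fourier inversion on A
    shows that sigma_X is the function chi(1) chi (sigma_transport_chars), so
    it is constant on the superclasses.  The numbers of parts agree because G
    has as many irreducible characters as conjugacy classes.  Finally, the
    algebra of a supercharacter theory consists of the functions that are
    constant on superclasses (mem_sc_algebraP), so it is clear that the
    bijection maps one algebra onto the other. *)

Set Implicit Arguments.
Unset Strict Implicit.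
Unset Printing Implicit Defensive.

Import GRing.Theory.
Local Open Scope ring_scope.

(** * Fourier transform on a finite abelian group *)

Section Fourier.

Variable aT : finGroupType.
Local Notation G := [set: aT].
Implicit Types (p q : aT -> algC) (l : Iirr G).

Definition fourier p l : algC :=
  #|G|%:R^-1 * \sum_u p u * 'chi_l u^-1%g.

Lemma eq_fourier p q : p =1 q -> fourier p =1 fourier q.
Proof.
move=> eq_pq l; rewrite /fourier; congr (_ * _).
by apply: eq_bigr => u _; rewrite eq_pq.
Qed.

Lemma fourier_scale (c : algC) p l :
  fourier (fun w => c * p w) l = c * fourier p l.
Proof.
rewrite /fourier mulrCA; congr (_ * _); rewrite mulr_sumr.
by apply: eq_bigr => u _; rewrite mulrA.
Qed.

Lemma fourier_sum (I : finType) (p : I -> aT -> algC) l :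
  fourier (fun w => \sum_i p i w) l = \sum_i fourier (p i) l.
Proof.
rewrite /fourier -mulr_sumr exchange_big; congr (_ * _).
by apply: eq_bigr => u _; rewrite mulr_suml.
Qed.

Lemma fourier_irr k l : fourier 'chi_k l = (k == l)%:R.
Proof.
by rewrite /fourier -(first_orthogonality_relation k l);
   congr (_ * _); apply: eq_bigl => u; rewrite inE.
Qed.

Hypothesis abG : abelian G.

(** Column orthogonality: in an abelian group conjugacy classes are singletons
    and all centralisers are the whole group. *)
Lemma fourier_inversion p w : \sum_l fourier p l * 'chi_l w = p w.
Proof.
rewrite /fourier.
under eq_bigr => l _ do rewrite -mulrA mulr_suml.
rewrite -mulr_sumr exchange_big /=.
have ortho u : \sum_l p u * 'chi[G]_l u^-1%g * 'chi_l w
                 = p u * (#|G|%:R *+ (u == w)).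
  under eq_bigr => l _ do rewrite -mulrA irr_inv [_^* * _]mulrC.
  rewrite -mulr_sumr (second_orthogonality_relation w (in_setT u)).
  congr (_ * (_%:R *+ _)).
    by rewrite (setIidPl _) // sub_cent1 (subsetP abG) ?inE.
  rewrite class_sym -sub1set; congr nat_of_bool.
  rewrite (_ : (w ^: G)%g = [set w]) ?sub1set ?inE //.
  by apply/abelian_classP; rewrite ?inE.
under eq_bigr => u _ do rewrite ortho.
rewrite (bigD1 w) //= eqxx big1 => [|u /negPf->]; last by rewrite mulr0.
by rewrite addr0 mulrCA mulVf ?mulr1 // neq0CG.
Qed.

(** The characters of an abelian group are multiplicative; the factor |G| comes
    from the normalisation of [fourier]. *)
Lemma fourier_conv p q l :
  fourier (fun w => \sum_u p u * q (u^-1 * w)%g) l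
  = #|G|%:R * fourier p l * fourier q l.
Proof.
have lin_l : 'chi[G]_l \is a linear_char by apply/char_abelianP.
rewrite /fourier mulVKf ?neq0CG // [RHS]mulrCA; congr (_ * _).
rewrite [RHS]mulr_suml.
under eq_bigr => w _ do rewrite mulr_suml.
rewrite exchange_big; apply: eq_bigr => u _ /=.
rewrite mulr_sumr (reindex_inj (mulgI u)); apply: eq_bigr => v _.
by rewrite mulKg invMg lin_charM ?inE // [X in _ * X = _]mulrC mulrACA.
Qed.

End Fourier.

(** * The central idempotents of a group algebra *)

Section CharacterSpectrum.

Variable gT : finGroupType.
Local Notation G := [set: gT].
Implicit Types i j : Iirr G.

(** This is |G| times the central idempotent attached to the dual of ['chi_i];
    leaving out the inverse of the argument makes it the [sigma] of a
    singleton. *)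
Definition scaled_irr i : gT -> algC := fun x => 'chi_i 1%g * 'chi_i x.

Lemma scaled_irrJ i x z : scaled_irr i (x ^ z)%g = scaled_irr i x.
Proof. by rewrite /scaled_irr cfunJ ?inE. Qed.

(** The second factor of the generalized orthogonality relation has the argument
    [x^-1], not [x^-1 * y]; the substitution of [y * x] for [x] moves [y] to the
    first factor, where it can change sides because characters are class
    functions. *)
Lemma scaled_irr_conv i j y :
  \sum_x scaled_irr i x * scaled_irr j (x^-1 * y)%g
  = (i == j)%:R * (#|G|%:R * scaled_irr i y).
Proof.
have := generalized_orthogonality_relation y i j.
move/(canRL (mulVKf (neq0CG _))) => ortho.
have ->: \sum_x scaled_irr i x * scaled_irr j (x^-1 * y)%g
       = 'chi_i 1%g * 'chi_j 1%g
         * \sum_(x in G) 'chi_i (x * y)%g * 'chi_j x^-1%g.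
  rewrite mulr_sumr (reindex_inj (mulgI y)).
  apply: eq_big => x; rewrite ?inE //.
  rewrite invMg mulgKV (_ : y * x = (x * y) ^ x)%g.
    by rewrite scaled_irrJ /scaled_irr mulrACA.
  by rewrite conjgE -mulgA mulKg.
rewrite ortho; case: eqP => [<-|_]; last by rewrite !mul0r !mulr0.
by rewrite /scaled_irr; field; rewrite irr1_neq0.
Qed.

Lemma scaled_irr_sum x : \sum_i scaled_irr i x = #|G|%:R *+ (x == 1%g).
Proof.
rewrite -cfRegE cfReg_sum sum_cfunE.
by apply: eq_bigr => i _; rewrite cfunE.
Qed.

Lemma scaled_irr0 x : scaled_irr 0 x = 1.
Proof. by rewrite /scaled_irr irr0 !cfun1E !inE mul1r. Qed.

Lemma scaled_irr1_neq0 i : scaled_irr i 1%g != 0.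
Proof. by rewrite mulf_neq0 ?irr1_neq0. Qed.

End CharacterSpectrum.

(** * Functions constant on superclasses *)

Section Membership.

Variables (F : fieldType) (gT : finGroupType) (T : scTheory gT).
Implicit Types (x y : gT) (D E : {set {set gT}}).

Lemma mem_cover_superclass x : exists2 D, D \in sc_classes T & x \in cover D.
Proof.
have [partT _] :=
  partition_partition (classes_partition _) (sc_classes_partition T).
have : x \in [set: gT] by rewrite inE.
rewrite -(cover_partition partT) => /bigcupP[_ /imsetP[D TD ->] Dx].
by exists D.
Qed.

Lemma superclass_inj D E x : D \in sc_classes T -> E \in sc_classes T ->
  x \in cover D -> x \in cover E -> D = E.
Proof.
have [] := partition_partition (classes_partition _) (sc_classes_partition T).
move=> /and3P[_ trivT _] injT TD TE Dx Ex; apply: injT => //.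
rewrite -(def_pblock trivT _ Dx) ?imset_f //.
by rewrite (def_pblock trivT _ Ex) ?imset_f.
Qed.

(** A function constant on superclasses is the combination of class sums whose
    coefficients are its values at representatives, as the superclasses
    partition the group. *)
Lemma mem_sc_algebraP (a : galg F gT) :
  reflect (forall D, D \in sc_classes T ->
             {in cover D &, forall x y, a x = a y})
          (a \in sc_algebra F T).
Proof.
apply: (iffP idP) => [|a_const].
  rewrite /sc_algebra => a_span D TD x y Dx Dy.
  set s := [seq _ | L in _] in a_span.
  rewrite (coord_span (X := in_tuple s) a_span) !sum_ffunE.
  apply: eq_bigr => i _; rewrite !ffunE; congr (_ *: _).
  have /mapP[L] : (in_tuple s)`_i \in s by rewrite mem_nth.
  rewrite mem_enum => TL ->; rewrite !ffunE; congr (nat_of_bool _)%:R.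
  apply/idP/idP => Lz; first by rewrite (superclass_inj TL TD Lz Dx).
  by rewrite (superclass_inj TL TD Lz Dy).
have -> : a = \sum_(D in sc_classes T) a (repr (cover D)) *: class_sum F D.
  apply/ffunP=> x; rewrite sum_ffunE.
  have [D TD Dx] := mem_cover_superclass x.
  rewrite (bigD1 D) //= big1 => [|E /andP[TE neq_ED]]; rewrite !ffunE.
    rewrite Dx addr0 (a_const D TD x (repr (cover D))) ?(mem_repr x) //.
    by rewrite /GRing.scale /= mulr1.
  case Ex: (x \in cover E); last by rewrite scaler0.
  by rewrite (superclass_inj TE TD Ex Dx) eqxx in neq_ED.
apply: memv_suml => D TD; apply/memvZ/memv_span.
by apply/mapP; exists D; rewrite ?mem_enum.
Qed.

End Membership.

(** * Transport of the minimal theory to an abelian group *)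

Section Transport.

Variables (gT aT : finGroupType) (f : gT -> aT) (g : aT -> gT).
Hypotheses (fK : cancel f g) (gK : cancel g f).
Hypothesis ldiv_class : forall u w : aT,
  g (u^-1 * w)%g \in (((g u)^-1 * g w) ^: [set: gT])%g.

(** Convolution with a class function is the same for the two group laws, since
    a class function takes equal values at the two left quotients. *)
Lemma transport_conv (S : pzSemiRingType) (p q : gT -> S) (w : aT) :
    (forall x z, q (x ^ z)%g = q x) ->
  \sum_u p (g u) * q (g (u^-1 * w)%g) = \sum_x p x * q (x^-1 * g w)%g.
Proof.
move=> qJ; rewrite [RHS](reindex g); last by exists f => ? _; rewrite ?fK ?gK.
by apply: eq_bigr => u _; have /imsetP[z _ ->] := ldiv_class u w; rewrite qJ.
Qed.

Lemma transport1 : f 1%g = 1%g.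
Proof.
have := ldiv_class 1 1; rewrite !mulVg class1G => /set1P <-.
exact: gK.
Qed.

Local Notation G := [set: gT].
Local Notation A := [set: aT].
Hypothesis abA : abelian A.

Definition transport_coef (i : Iirr G) (l : Iirr A) : algC :=
  fourier (scaled_irr i \o g) l.

Local Notation c := transport_coef.

Lemma transport_coef_mul i j l : c i l * c j l = (i == j)%:R * c i l.
Proof.
have := fourier_conv abA (scaled_irr i \o g) (scaled_irr j \o g) l.
rewrite -mulrA.
have /eq_fourier -> :
      (fun w => \sum_u (scaled_irr i \o g) u * (scaled_irr j \o g) (u^-1 * w)%g)
   =1 (fun w => (i == j)%:R * #|A|%:R * (scaled_irr i \o g) w).
  move=> w; rewrite /= transport_conv; last by move=> x z; rewrite scaled_irrJ.
  by rewrite scaled_irr_conv mulrA !cardsT (bij_eq_card (Bijective gK fK)).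
by rewrite fourier_scale [_%:R * _]mulrC -mulrA => /(mulfI (neq0CG _)).
Qed.

(** The regular character of G becomes that of A, in which the linear character
    ['chi_l] occurs once. *)
Lemma transport_coef_sum l : \sum_i c i l = 1.
Proof.
have lin_l : 'chi[A]_l \is a linear_char by apply/char_abelianP.
rewrite -fourier_sum.
have /eq_fourier -> : (fun w => \sum_i (scaled_irr i \o g) w)
                   =1 (fun w => \sum_(k : Iirr A) scaled_irr k w).
  move=> w; rewrite !scaled_irr_sum !cardsT (bij_eq_card (Bijective gK fK)).
  by rewrite -(can_eq gK) -transport1 fK.
rewrite fourier_sum (bigD1 l) //= big1 => [|k neq_kl].
  by rewrite fourier_scale fourier_irr eqxx lin_char1 // mulr1 addr0.
by rewrite fourier_scale fourier_irr (negPf neq_kl) mulr0.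
Qed.

Lemma transport_coef0 l : c 0 l = (l == 0)%:R.
Proof.
rewrite eq_sym -fourier_irr; apply: eq_fourier => w.
by rewrite /= scaled_irr0 irr0 cfun1E inE.
Qed.

(** The coefficients [c i l] are idempotent, so the [c i] are the indicator
    functions of their supports. *)
Definition transport_chars (i : Iirr G) : {set Iirr A} := [set l | c i l != 0].

Local Notation X := transport_chars.

Lemma transport_coefE i l : c i l = (l \in X i)%:R.
Proof.
rewrite inE; case: eqP => //= /eqP nz_c; apply: (mulfI nz_c).
by rewrite transport_coef_mul eqxx mul1r mulr1.
Qed.

(** Linear characters have degree 1, so that the left-hand side is the sum of
    the [c i l * 'chi_l], to which Fourier inversion applies. *)
Lemma sigma_transport_chars i w : sigma (X i) w = scaled_irr i (g w).
Proof.
have lin l : 'chi[A]_l \is a linear_char by apply/char_abelianP.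
rewrite -[RHS](fourier_inversion abA (scaled_irr i \o g)).
rewrite /sigma sum_cfunE big_mkcond.
apply: eq_bigr => l _.
rewrite -/(c i l) transport_coefE cfunE lin_char1 // mul1r.
by case: ifP => _; rewrite ?mul1r ?mul0r.
Qed.

Lemma transport_chars_neq0 i : X i != set0.
Proof.
apply: contra_neq (scaled_irr1_neq0 i) => X0.
have := sigma_transport_chars i 1%g.
by rewrite X0 /sigma big_set0 cfunE -transport1 fK.
Qed.

Lemma transport_chars_disjoint i j : i != j -> [disjoint X i & X j].
Proof.
move=> neq_ij; apply/pred0P => l /=; rewrite !inE.
have := transport_coef_mul i j l; rewrite (negPf neq_ij) mul0r => /eqP.
by rewrite mulf_eq0; case: eqP => //= _ ->.
Qed.

Lemma transport_chars_cover l : exists i, l \in X i.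
Proof.
apply/existsP; apply: contraTT isT => /existsPn no_i.
have := transport_coef_sum l; rewrite big1 => [/eqP|i _].
  by rewrite eq_sym oner_eq0.
by rewrite transport_coefE (negPf (no_i i)).
Qed.

Lemma transport_chars0 : X 0 = [set 0].
Proof.
apply/setP=> l; rewrite !inE transport_coef0.
by case: (l == 0); rewrite ?oner_neq0 ?eqxx.
Qed.

(** The conjugacy classes of an abelian group are singletons, so a part of its
    superclass partition is a set of singletons. *)
Definition transport_class (C : {set gT}) : {set {set aT}} :=
  [set [set f x] | x in C].

Local Notation L := transport_class.

Lemma transport_set1_inj : injective (fun x => [set f x]).
Proof. by move=> x y /set1_inj /(can_inj fK). Qed.

Lemma transport_class_inj : injective L.
Proof. exact: imset_inj transport_set1_inj. Qed.

Lemma cover_transport_class C : cover (L C) = [set w | g w \in C].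
Proof.
apply/setP=> w; rewrite inE; apply/bigcupP/idP.
  by case=> _ /imsetP[x Cx ->] /set1P ->; rewrite fK.
by move=> Cw; exists [set w]; rewrite ?set11 // -[w]gK imset_f // gK.
Qed.

Definition transport_charsets := [set X i | i : Iirr G].
Definition transport_classes := [set L C | C in classes G].

Lemma transport_chars_partition : partition transport_charsets [set: Iirr A].
Proof.
have [|i _|partX _] := @indexed_partition _ _ predT X.
- by move=> i j _ _; rewrite eq_sym; exact: transport_chars_disjoint.
- exact: transport_chars_neq0.
suffices <- : cover [set X i | i in predT] = [set: Iirr A] by [].
apply/setP=> l; rewrite inE; apply/bigcupP.
by have [i Xl] := transport_chars_cover l; exists (X i); rewrite ?imset_f.
Qed.

Lemma transport_classes_partition : partition transport_classes (classes A).
Proof.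
suffices <- : [set [set f x] | x in G] = classes A.
  by rewrite (imset_partition _ _ transport_set1_inj) classes_partition.
(* The classes of A are the singletons, each of which contains some [f x]. *)
apply/setP=> C; apply/imsetP/imsetP=> [[x _ ->]|[w _ ->]].
  by exists (f x); rewrite ?inE // (abelian_classP _ abA) ?inE.
by exists (g w); rewrite ?inE // gK (abelian_classP _ abA) ?inE.
Qed.

Lemma transport_class1 : [set [set 1%g]] \in transport_classes.
Proof.
apply/imsetP; exists [set 1%g]; first exact: classes1.
by rewrite /L imset_set1 transport1.
Qed.

Lemma transport_char1 : [set 0] \in transport_charsets.
Proof. by rewrite -transport_chars0 imset_f. Qed.

Lemma transport_card : #|transport_charsets| = #|transport_classes|.
Proof.
have injX : injective X.
  move=> i j eqX; apply: contraTeq (transport_chars_neq0 i) => neq_ij.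
  have := transport_chars_disjoint neq_ij.
  by rewrite eqX -setI_eq0 setIid negbK.
rewrite (card_imset _ injX) (card_imset _ transport_class_inj).
by rewrite card_ord NirrE.
Qed.

Lemma transport_constant Y D :
    Y \in transport_charsets -> D \in transport_classes ->
  {in cover D &, forall w1 w2, sigma Y w1 = sigma Y w2}.
Proof.
move=> /imsetP[i _ ->] /imsetP[_ /imsetP[x _ ->] ->] w1 w2.
rewrite cover_transport_class !inE !sigma_transport_chars.
by move=> /imsetP[y _ ->] /imsetP[z _ ->]; rewrite !scaled_irrJ.
Qed.

Definition transport_theory : scTheory aT :=
  ScTheory transport_chars_partition transport_classes_partition
    transport_class1 transport_char1 transport_card transport_constant.

(** Composition with the bijection preserves pointwise products trivially, and
    convolutions by [transport_conv], as the elements of the second algebra are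
    class functions. *)
Lemma transport_isomorphic (F : fieldType) :
  sc_isomorphic F transport_theory (minimal_theory gT).
Proof.
pose phi (a : galg F aT) : galg F gT := [ffun x => a (f x)].
have phiP a : (a \in sc_algebra F transport_theory)
            = (phi a \in sc_algebra F (minimal_theory gT)).
  apply/mem_sc_algebraP/mem_sc_algebraP => a_const.
    move=> _ /imsetP[C classC ->] x y; rewrite /cover big_set1 => Cx Cy.
    rewrite !ffunE; apply: (a_const (L C)); first by rewrite imset_f.
      by rewrite cover_transport_class inE fK.
    by rewrite cover_transport_class inE fK.
  move=> _ /imsetP[C classC ->] u w.
  rewrite cover_transport_class !inE => Cu Cw.
  have := a_const [set C] (imset_f _ classC) (g u) (g w).
  by rewrite /cover big_set1 !ffunE !gK; exact.
exists phi; split; first split.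
- by move=> a; rewrite phiP.
- by move=> c a b _ _; apply/ffunP=> x; rewrite !ffunE.
- move=> a b _; rewrite phiP => /mem_sc_algebraP b_const; apply/ffunP=> x.
  rewrite !ffunE -[x in RHS]fK -(transport_conv (phi a) (q := phi b)).
    by apply: eq_bigr => u _; rewrite !ffunE !gK.
  move=> y z; apply: (b_const [set (y ^: G)%g]).
  + by rewrite imset_f // mem_classes ?inE.
  + by rewrite /cover big_set1 memJ_class ?inE.
  + by rewrite /cover big_set1 class_refl.
- by move=> a b _ _; apply/ffunP=> x; rewrite !ffunE.
- move=> a b _ _ /ffunP eq_ab; apply/ffunP=> w.
  by have := eq_ab (g w); rewrite !ffunE gK.
move=> b Bb; have phiK : phi [ffun w => b (g w)] = b.
  by apply/ffunP=> x; rewrite !ffunE fK.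
by exists [ffun w => b (g w)]; rewrite ?phiP phiK.
Qed.

End Transport.

(** * Semidirect products *)

(** Both sides have second component (u^-1 w).2, and conjugation by (1, u.2)
    applies psi (u.2^-1) to the first component; this is exactly the twist that
    inversion of u produces in the semidirect product.  It leaves the second
    component alone because K is abelian. *)
Lemma semidirect_ldiv_class (hT kT : finGroupType) (psi : aut_hom kT hT)
    (abK : abelian [set: kT]) (u w : hT * kT) :
  SemiPair psi (u^-1 * w)%g
    \in (((SemiPair psi u)^-1 * SemiPair psi w) ^: [set: semidirect psi])%g.
Proof.
rewrite class_sym; apply/imsetP.
exists (SemiPair psi (1%g, u.2)); rewrite ?inE //.
case: u w => [a b] [h k].
have psi1 x : psi x 1%g = 1%g.
  by apply: (mulgI (psi x 1%g)); rewrite -psi_morph !mulg1.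
apply: val_inj; rewrite /conjg; congr (_, _) => /=.
  by rewrite psi1 mulg1 invg1 psi1 mul1g psi_morph.
by rewrite (centsP abK (b^-1 * k)%g _ b) ?inE // mulKg.
Qed.

Theorem theorem2 (R : realType) (hT kT : finGroupType)
    (abH : abelian [set: hT]) (abK : abelian [set: kT])
    (psi : aut_hom kT hT) :
  exists A : scTheory (hT * kT)%type,
    sc_isomorphic R[i] A (minimal_theory (semidirect psi)).
Proof.
have abHK : abelian [set: hT * kT].
  apply/centsP=> -[h1 k1] _ [h2 k2] _.
  by congr (_, _); [apply: (centsP abH) | apply: (centsP abK)]; rewrite inE.
have fK : cancel (@sd_val _ _ psi) (@SemiPair _ _ psi) by case.
have gK : cancel (@SemiPair _ _ psi) (@sd_val _ _ psi) by [].
exists (transport_theory fK gK (semidirect_ldiv_class psi abK) abHK).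
exact: transport_isomorphic.
Qed.
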